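(* Let $d=(d_1,d_2)\in\mathbb{R}^2$ with $d_1\ge 0$, $d_2\ge 0$, $d_1d_2\ge 1$, and let $$\mathcal Z_+=\left\{(x,y,t)\in\mathcal I_2\times\mathbb{R}_+:\ t\ge d_1y_1^2+2y_1y_2+d_2y_2^2\right\}.$$ Define $$f(x,y,\lambda;d)=\frac{(d_1d_2-1)(d_1x_2y_1^2+d_2x_1y_2^2)+2\lambda d_1d_2y_1y_2+\lambda(d_1y_1^2+d_2y_2^2)}{(d_1d_2-1)x_1x_2-\lambda^2+\lambda(x_1+x_2)}$$ and $$f_+^*(x,y;d)=\begin{cases}\dfrac{d_1y_1^2}{x_1}+\dfrac{d_2y_2^2}{x_2}&\text{if }x_1+x_2\le 1,\\[2mm] \dfrac{d_2y_2^2}{x_2}+\dfrac{d_1y_1^2}{1-x_2}&\text{if }0\le x_1+x_2-1\le (x_1y_2-d_1x_2y_1)/y_2,\\[2mm] \dfrac{d_1y_1^2}{x_1}+\dfrac{d_2y_2^2}{1-x_1}&\text{if }0\le x_1+x_2-1\le (x_2y_1-d_2x_1y_2)/y_1,\\[2mm] f(x,y,x_1+x_2-1;d)&\text{otherwise.}\end{cases}$$ Then $$\operatorname{cl}\operatorname{conv}(\mathcal Z_+)=\left\{(x,y,t)\in[0,1]^2\times\mathbb{R}^3_+:\ t\ge f_+^*(x,y;d)\right\}.$$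
   Context: $\mathcal I_2=\{(x,y)\in\{0,1\}^2\times\mathbb{R}^2_+: y_i(1-x_i)=0,\ i=1,2\}$; $x=(x_1,x_2)$, $y=(y_1,y_2)$. $\operatorname{cl}\operatorname{conv}$ denotes the closure of the convex hull. Division by zero convention for function values: for a nonnegative numerator $q$, $q/0=+\infty$ if $q\ne 0$ and $q/0=0$ if $q=0$. In the conditions defining the second and third cases, when the denominator $y_2$ (respectively $y_1$) is zero, the upper inequality is read in the form multiplied through by that denominator, i.e. $(x_1+x_2-1)y_2\le x_1y_2-d_1x_2y_1$ (respectively $(x_1+x_2-1)y_1\le x_2y_1-d_2x_1y_2$). *)

(* Defs.v *)
(* MathComp-Analysis; [R : realType] is the real line. *)
From HB Require Import structures.
From mathcomp Require Import all_boot all_order all_algebra.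
From mathcomp Require Import all_classical all_reals all_analysis.

Set Implicit Arguments.
Unset Strict Implicit.
Unset Printing Implicit Defensive.

Import Order.TTheory GRing.Theory Num.Theory.
Import numFieldNormedType.Exports.

Local Open Scope classical_set_scope.
Local Open Scope ring_scope.

(* A pair (u_1, u_2) of reals is a row vector [u : 'rV[R]_2]; indices start at
   0, so u_1 is [u 0 0] and u_2 is [u 0 1]. A point (x, y, t) is
   [((x, y), t)]; [R^o] is R as a module over itself. *)
Notation xyt_space R := ('rV[R]_2 * 'rV[R]_2 * R^o)%type.

Definition conv_hull (R : numDomainType) (M : lmodType R) (A : set M) : set M :=
  smallest (@convex_set R M) A.

Definition I2 (R : realType) : set ('rV[R]_2 * 'rV[R]_2) :=
  [set p : 'rV[R]_2 * 'rV[R]_2 | forall i : 'I_2,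
     [/\ p.1 0 i = 0 \/ p.1 0 i = 1, 0 <= p.2 0 i
       & p.2 0 i * (1 - p.1 0 i) = 0]].

Definition Zplus (R : realType) (d : 'rV[R]_2) : set (xyt_space R) :=
  [set p : xyt_space R | let y := p.1.2 in
     [/\ I2 p.1, 0 <= p.2
       & d 0 0 * y 0 0 ^+ 2 + 2 * y 0 0 * y 0 1 + d 0 1 * y 0 1 ^+ 2 <= p.2]].

(* Quotient of reals with value in the extended reals: since [0^-1 = +oo] and
   [0 * +oo = 0] in [\bar R], for q >= 0 the value of q / 0 is +oo if q != 0
   and 0 if q = 0. *)
Definition equot (R : realType) (q r : R) : \bar R := (q%:E / r%:E)%E.

(* l <= a / b, read as l * b <= a when b = 0. *)
Definition le_quot (R : realType) (l a b : R) : bool :=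
  if b == 0 then l * b <= a else l <= a / b.

Definition f (R : realType) (x y : 'rV[R]_2) (lam : R) (d : 'rV[R]_2) :
    \bar R :=
  let x1 := x 0 0 in let x2 := x 0 1 in
  let y1 := y 0 0 in let y2 := y 0 1 in
  let d1 := d 0 0 in let d2 := d 0 1 in
  equot
    ((d1 * d2 - 1) * (d1 * x2 * y1 ^+ 2 + d2 * x1 * y2 ^+ 2)
       + 2 * lam * d1 * d2 * y1 * y2
       + lam * (d1 * y1 ^+ 2 + d2 * y2 ^+ 2))
    ((d1 * d2 - 1) * x1 * x2 - lam ^+ 2 + lam * (x1 + x2)).

(* The first applicable case is used; on [0,1]^2 x R_+^2 the values agree
   wherever two of the first three cases apply (for d_1, d_2 > 0). *)
Definition fplus (R : realType) (x y d : 'rV[R]_2) : \bar R :=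
  let x1 := x 0 0 in let x2 := x 0 1 in
  let y1 := y 0 0 in let y2 := y 0 1 in
  let d1 := d 0 0 in let d2 := d 0 1 in
  if x1 + x2 <= 1 then
    (equot (d1 * y1 ^+ 2) x1 + equot (d2 * y2 ^+ 2) x2)%E
  else if (0 <= x1 + x2 - 1)
          && le_quot (x1 + x2 - 1) (x1 * y2 - d1 * x2 * y1) y2 then
    (equot (d2 * y2 ^+ 2) x2 + equot (d1 * y1 ^+ 2) (1 - x2))%E
  else if (0 <= x1 + x2 - 1)
          && le_quot (x1 + x2 - 1) (x2 * y1 - d2 * x1 * y2) y1 then
    (equot (d1 * y1 ^+ 2) x1 + equot (d2 * y2 ^+ 2) (1 - x1))%E
  else f x y (x1 + x2 - 1) d.

(* Main.v *)
Require Import Defs.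
From mathcomp Require Import all_boot all_order all_algebra.
From mathcomp Require Import all_classical all_reals all_analysis.
From mathcomp Require Import ring lra.

Import Order.TTheory GRing.Theory Num.Theory.
Import numFieldNormedType.Exports.

Local Open Scope classical_set_scope.
Local Open Scope ring_scope.

(** Write lam = x1 + x2 - 1 and q for the quadratic form
    d1 y1^2 + 2 y1 y2 + d2 y2^2, which is positive semidefinite because
    d1 d2 >= 1.

    A point of the hull is a mixture of points above the four vertices of
    [0,1]^2. The product y1 y2 is nonnegative, so weight on the vertex (1,1)
    only costs; it is best to put as little there as possible, namely
    max (0, lam). For lam <= 0 the vertex (1,1) is left out and the two
    variables separate, which gives a sum of two perspectives. For lam >= 0 the
    vertex (0,0) is left out, the weights of (1,1), (1,0), (0,1) are lam,
    1 - x2, 1 - x1, and it remains to choose the y-parts r = (r1, r2) above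
    (1,1), p1 above (1,0) and p2 above (0,1) so as to minimize
    lam q(r) + (1 - x2) d1 p1^2 + (1 - x1) d2 p2^2. The optimality conditions
    of this convex program are the predicate [stationary]. The cases of fplus
    beyond the first are its three solutions: r1 = 0, r2 = 0, and r interior;
    in all of them the optimal value is d1 p1 y1 + d2 p2 y2
    ([fplus_stationary]).

    Neither the convexity nor the closedness of the right-hand side is proved
    directly; instead, at each point the value of fplus is certified from both
    sides. The optimal mixture, a combination of at most three points of Zplus,
    shows that everything above the value lies in the hull. For the other side,
    the affine function with y-gradient 2 (d1 p1, d2 p2) and offsets chosen to
    touch the pieces above the three vertices in use minorizes t on Zplus
    ([cl_hull_cut]); its half-space is convex and closed, hence contains the
    closed hull, and at the given point the function takes exactly the value of
    the mixture. The two certificates meet in [cl_hull_perspective] and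
    [cl_hull_stationary]. An infinite value (x_i = 0 < y_i) is certified by the
    same cuts with p_i growing without bound ([cl_hull_support]). *)

Set Implicit Arguments.
Unset Strict Implicit.

(** * Convex combinations and convex hulls *)

Section ConvexHull.
Context {R : realType} {M : lmodType R}.
Implicit Types A C : set M.

(** Lets computed weights such as b / (b + c) be used: elements of {i01 R} carry
    their bounds in their type. *)
Lemma convex_setP C : convex_set C <->
  forall (k : R) u v, 0 <= k <= 1 -> C u -> C v -> C (k *: u + (1 - k) *: v).
Proof.
split=> [cC k u v k01 Cu Cv|cC u v k /set_mem Cu /set_mem Cv].
  have k01' : Itv.spec (@Itv.num_sem R) (Itv.Real `[0%Z, 1%Z]) k.
    by rewrite /Itv.spec /Itv.num_sem /= in_itv /= num_real.
  by have /set_mem := cC u v (Itv.mk k01') (mem_set Cu) (mem_set Cv).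
by apply/mem_set; apply: cC => //; rewrite ge0 le1.
Qed.

Lemma convex_conv_hull A : convex_set (conv_hull A).
Proof.
apply/convex_setP => k u v k01 Au Av C [cC AC].
by apply: (convex_setP C).1 => //; [exact: Au|exact: Av].
Qed.

Lemma sub_conv_hull A : A `<=` conv_hull A.
Proof. by move=> u Au C [_]; apply. Qed.

Lemma convex_comb3 C (a b c : R) u v w : convex_set C ->
  0 <= a -> 0 <= b -> 0 <= c -> a + b + c = 1 -> C u -> C v -> C w ->
  C (a *: u + b *: v + c *: w).
Proof.
move=> /convex_setP cC a0 b0 c0 abc Cu Cv Cw.
have [bc0|bc0] := eqVneq (b + c) 0.
  have -> : b = 0 by lra.
  have -> : c = 0 by lra.
  have -> : a = 1 by lra.
  by rewrite !scale0r !addr0 scale1r.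
have bc_gt0 : 0 < b + c by rewrite lt_def bc0 addr_ge0.
have -> : a *: u + b *: v + c *: w =
    a *: u + (1 - a) *: ((b / (b + c)) *: v + (1 - b / (b + c)) *: w).
  rewrite -addrA; congr (_ + _); have -> : 1 - a = b + c by lra.
  by rewrite scalerDr !scalerA; congr (_ *: _ + _ *: _); field.
apply: (cC) => //; first by lra.
apply: (cC) => //; rewrite divr_ge0 ?addr_ge0//= ler_pdivrMr// mul1r; lra.
Qed.

End ConvexHull.

(** * Scalar coordinates and closed half-spaces *)

Section Scalars.
Context {R : realType}.

Definition pair_row (a b : R) : 'rV[R]_2 := \row_i (if i == 0 then a else b).

Definition pt (x1 x2 y1 y2 t : R) : xyt_space R :=
  (pair_row x1 x2, pair_row y1 y2, t).

Lemma pair_row0 a b : pair_row a b 0 0 = a. Proof. by rewrite mxE. Qed.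
Lemma pair_row1 a b : pair_row a b 0 1 = b. Proof. by rewrite mxE. Qed.

Lemma forall_ord2 (P : 'I_2 -> Prop) : (forall i, P i) <-> P 0 /\ P 1.
Proof.
split=> [H|[P0 P1] i]; first by split.
by have [->|->] : i = 0 \/ i = 1;
  [case: i => -[|[|//]] i; [left|right]; apply/val_inj | |].
Qed.

Lemma pair_row_eta (u : 'rV[R]_2) : u = pair_row (u 0 0) (u 0 1).
Proof. by apply/rowP; apply/forall_ord2; rewrite pair_row0 pair_row1. Qed.

Lemma pt_eta (p : xyt_space R) :
  p = pt (p.1.1 0 0) (p.1.1 0 1) (p.1.2 0 0) (p.1.2 0 1) p.2.
Proof. by case: p => -[x y] t; rewrite /pt -!pair_row_eta. Qed.

Lemma Zplus_pt (d : 'rV[R]_2) x1 x2 y1 y2 t :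
  Zplus d (pt x1 x2 y1 y2 t) <->
  [/\ x1 = 0 \/ x1 = 1, x2 = 0 \/ x2 = 1, 0 <= y1 /\ y1 * (1 - x1) = 0,
      0 <= y2 /\ y2 * (1 - x2) = 0 &
      0 <= t /\ d 0 0 * y1 ^+ 2 + 2 * y1 * y2 + d 0 1 * y2 ^+ 2 <= t].
Proof.
rewrite /Zplus/= !pair_row0 !pair_row1.
split=> [[/forall_ord2[]/=]|[h1 h2 [h3 h4] [h5 h6] [h7 h8]]].
  by rewrite !pair_row0 !pair_row1 => -[? ? ?] [? ? ?].
by split => //; apply/forall_ord2; rewrite /= !pair_row0 !pair_row1.
Qed.

Definition halfspace (c a1 a2 b1 b2 e : R) : set (xyt_space R) :=
  [set p : xyt_space R | 0 <= c + a1 * p.1.1 0 0 + a2 * p.1.1 0 1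
              + b1 * p.1.2 0 0 + b2 * p.1.2 0 1 + e * p.2].

Lemma convex_halfspace c a1 a2 b1 b2 e : convex_set (halfspace c a1 a2 b1 b2 e).
Proof.
apply/convex_setP => k p q /andP[k0 k1]; rewrite /halfspace/= => hp hq.
rewrite !mxE /GRing.scale /=.
have := addr_ge0 (mulr_ge0 k0 hp) (mulr_ge0 (_ : 0 <= 1 - k) hq).
rewrite subr_ge0 => /(_ k1); congr (_ <= _); ring.
Qed.

Lemma closed_halfspace c a1 a2 b1 b2 e : closed (halfspace c a1 a2 b1 b2 e).
Proof.
pose h (p : xyt_space R) : R := c + a1 * p.1.1 0 0 + a2 * p.1.1 0 1
              + b1 * p.1.2 0 0 + b2 * p.1.2 0 1 + e * p.2.
have -> : halfspace c a1 a2 b1 b2 e = h @^-1` [set r | 0 <= r] by [].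
apply: closed_comp; last exact: closed_ge.
move=> p _.
have cx i : {for p, continuous (fun p : xyt_space R => p.1.1 0 i)}.
  apply: (@continuous_comp _ _ _ (fun p : xyt_space R => p.1.1)
    (fun u : 'rV[R]_2 => u 0 i)); last exact: coord_continuous.
  by apply: continuous_comp; exact: cvg_fst.
have cy i : {for p, continuous (fun p : xyt_space R => p.1.2 0 i)}.
  apply: (@continuous_comp _ _ _ (fun p : xyt_space R => p.1.2)
    (fun u : 'rV[R]_2 => u 0 i)); last exact: coord_continuous.
  by apply: continuous_comp; [exact: cvg_fst|exact: cvg_snd].
have M r (g : xyt_space R -> R^o) : {for p, continuous g} ->
  {for p, continuous (fun q => r * g q : R^o)}.
  by move=> gp; apply: cvgM => //; exact: cvg_cst.
have D (g1 g2 : xyt_space R -> R^o) : {for p, continuous g1} ->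
    {for p, continuous g2} -> {for p, continuous (fun q => g1 q + g2 q : R^o)}.
  by move=> g1p g2p; apply: cvgD.
apply: (D _ _ _ (M _ _ cvg_snd)); do 2! apply: (D _ _ _ (M _ _ (cy _))).
by do 2! apply: (D _ _ _ (M _ _ (cx _))); exact: cvg_cst.
Qed.

Lemma closure_hull_halfspace (A : set (xyt_space R)) c a1 a2 b1 b2 e :
  A `<=` halfspace c a1 a2 b1 b2 e ->
  closure (conv_hull A) `<=` halfspace c a1 a2 b1 b2 e.
Proof.
move=> AH; rewrite closureE => p; apply; split; first exact: closed_halfspace.
by move=> q; apply; split => //; exact: convex_halfspace.
Qed.

End Scalars.

(** * The set Zplus and its valid inequalities *)

Section Hull.
Context {R : realType} {d : 'rV[R]_2}.
Hypotheses (d1_ge0 : 0 <= d 0 0) (d2_ge0 : 0 <= d 0 1).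
Hypothesis d1d2_ge1 : 1 <= d 0 0 * d 0 1.

Local Notation d1 := (d 0 0).
Local Notation d2 := (d 0 1).
Local Notation hullZ := (conv_hull (Zplus d)).

Definition quad (y1 y2 : R) := d1 * y1 ^+ 2 + 2 * y1 * y2 + d2 * y2 ^+ 2.

Let d1_gt0 : 0 < d1.
Proof.
by rewrite lt_def d1_ge0 andbT; apply: contraTneq d1d2_ge1 => ->; rewrite mul0r ler10.
Qed.

Let d2_gt0 : 0 < d2.
Proof.
by rewrite lt_def d2_ge0 andbT; apply: contraTneq d1d2_ge1 => ->; rewrite mulr0 ler10.
Qed.

Lemma quad_ge0 y1 y2 : 0 <= quad y1 y2.
Proof.
rewrite -(pmulr_rge0 _ d1_gt0) /quad.
have -> : d1 * (d1 * y1 ^+ 2 + 2 * y1 * y2 + d2 * y2 ^+ 2) =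
  (d1 * y1 + y2) ^+ 2 + (d1 * d2 - 1) * y2 ^+ 2 by ring.
by rewrite addr_ge0 ?sqr_ge0// mulr_ge0 ?sqr_ge0// subr_ge0.
Qed.

Lemma halfspace_pt c a1 a2 b1 b2 e (x1 x2 y1 y2 t : R) :
  halfspace c a1 a2 b1 b2 e (pt x1 x2 y1 y2 t) =
  (0 <= c + a1 * x1 + a2 * x2 + b1 * y1 + b2 * y2 + e * t) :> Prop.
Proof. by rewrite /halfspace/= !pair_row0 !pair_row1. Qed.

Lemma Zplus_cases (x1 x2 y1 y2 t : R) : Zplus d (pt x1 x2 y1 y2 t) ->
  [/\ 0 <= y1, 0 <= y2, 0 <= t, quad y1 y2 <= t &
  [\/ [/\ x1 = 0, x2 = 0, y1 = 0 & y2 = 0], [/\ x1 = 1, x2 = 0 & y2 = 0],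
     [/\ x1 = 0, x2 = 1 & y1 = 0] | x1 = 1 /\ x2 = 1]].
Proof.
move=> /Zplus_pt[[->|->] [->|->] [y10 h1] [y20 h2] [t0 qt]]; split=> //;
  move: h1 h2; rewrite ?subr0 ?subrr ?mulr1 ?mulr0 => h1 h2.
- by constructor 1.
- by constructor 3.
- by constructor 2.
- by constructor 4.
Qed.

Lemma cl_hull_halfspace c a1 a2 b1 b2 e (x1 x2 y1 y2 t : R) :
  (forall u1 u2 v1 v2 s : R, Zplus d (pt u1 u2 v1 v2 s) ->
    0 <= c + a1 * u1 + a2 * u2 + b1 * v1 + b2 * v2 + e * s) ->
  closure hullZ (pt x1 x2 y1 y2 t) ->
  0 <= c + a1 * x1 + a2 * x2 + b1 * y1 + b2 * y2 + e * t.
Proof.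
move=> Zh; rewrite -halfspace_pt; apply: closure_hull_halfspace => p.
by rewrite (pt_eta p) halfspace_pt => /Zh.
Qed.

Lemma cl_hull_box (x1 x2 y1 y2 t : R) : closure hullZ (pt x1 x2 y1 y2 t) ->
  [/\ 0 <= x1 <= 1, 0 <= x2 <= 1, 0 <= y1, 0 <= y2 & 0 <= t].
Proof.
move=> Hp.
have B c a1 a2 b1 b2 e := @cl_hull_halfspace c a1 a2 b1 b2 e x1 x2 y1 y2 t ^~ Hp.
split; [apply/andP; split|apply/andP; split| | |];
  [suff: 0 <= 0 + 1 * x1 + 0 * x2 + 0 * y1 + 0 * y2 + 0 * t by lra
  |suff: 0 <= 1 + -1 * x1 + 0 * x2 + 0 * y1 + 0 * y2 + 0 * t by lra
  |suff: 0 <= 0 + 0 * x1 + 1 * x2 + 0 * y1 + 0 * y2 + 0 * t by lra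
  |suff: 0 <= 1 + 0 * x1 + -1 * x2 + 0 * y1 + 0 * y2 + 0 * t by lra
  |suff: 0 <= 0 + 0 * x1 + 0 * x2 + 1 * y1 + 0 * y2 + 0 * t by lra
  |suff: 0 <= 0 + 0 * x1 + 0 * x2 + 0 * y1 + 1 * y2 + 0 * t by lra
  |suff: 0 <= 0 + 0 * x1 + 0 * x2 + 0 * y1 + 0 * y2 + 1 * t by lra];
  apply: B => u1 u2 v1 v2 s /Zplus_cases[? ? ? _];
  case=> [[]|[]|[]|[]] *; subst; lra.
Qed.

(** One cut for each slope (d1 p1, d2 p2): above (1,0) and (0,1) it is the
    tangent at p1, resp. p2, of the one-variable square; K is the freedom left
    at (1,1), where the cut reads 2 g.u - K <= q(u), and its bound is what makes
    the cut valid at the origin. The right-hand side keeps the weights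
    1 - x2, 1 - x1, x1 + x2 - 1 visible so that it can be compared with the
    cost of a mixture. *)
Lemma cl_hull_cut (p1 p2 K x1 x2 y1 y2 t : R) :
  K <= d1 * p1 ^+ 2 + d2 * p2 ^+ 2 ->
  (forall u1 u2, 0 <= u1 -> 0 <= u2 ->
     2 * (d1 * p1 * u1 + d2 * p2 * u2) <= quad u1 u2 + K) ->
  closure hullZ (pt x1 x2 y1 y2 t) ->
  2 * (d1 * p1 * y1 + d2 * p2 * y2) <=
    t + d1 * p1 ^+ 2 * (1 - x2) + d2 * p2 ^+ 2 * (1 - x1) + K * (x1 + x2 - 1).
Proof.
move=> Kle Kq Hp; rewrite -subr_ge0.
suff: 0 <= (d1 * p1 ^+ 2 + d2 * p2 ^+ 2 - K) + (K - d2 * p2 ^+ 2) * x1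
   + (K - d1 * p1 ^+ 2) * x2 + (- (2 * d1 * p1)) * y1 + (- (2 * d2 * p2)) * y2
   + 1 * t by congr (_ <= _); ring.
apply: cl_hull_halfspace Hp => u1 u2 v1 v2 s /Zplus_cases[v1_ge0 v2_ge0 s_ge0].
rewrite /quad => qs.
case=> [[-> -> -> ->]|[-> -> v20]|[-> -> v10]|[-> ->]].
- lra.
- subst v2; have := mulr_ge0 d1_ge0 (sqr_ge0 (v1 - p1)); lra.
- subst v1; have := mulr_ge0 d2_ge0 (sqr_ge0 (v2 - p2)); lra.
- have := Kq v1 v2 v1_ge0 v2_ge0; rewrite /quad; lra.
Qed.

(** * Explicit mixtures matching the cuts *)

Lemma hull_comb3 (a b c x1 x2 y1 y2 t : R) (u v w : xyt_space R) :
  0 <= a -> 0 <= b -> 0 <= c -> a + b + c = 1 ->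
  Zplus d u -> Zplus d v -> Zplus d w ->
  a *: u + b *: v + c *: w = pt x1 x2 y1 y2 t ->
  closure hullZ (pt x1 x2 y1 y2 t).
Proof.
move=> a0 b0 c0 abc Zu Zv Zw <-; apply: subset_closure.
by apply: (@convex_comb3 R _ hullZ) => //; [exact: convex_conv_hull| | |];
  exact: sub_conv_hull.
Qed.

Lemma comb3_pt (a b c x1 x2 y1 y2 t x1' x2' y1' y2' t' x1'' x2'' y1'' y2'' t'' : R) :
  a *: pt x1 x2 y1 y2 t + b *: pt x1' x2' y1' y2' t'
    + c *: pt x1'' x2'' y1'' y2'' t'' =
  pt (a * x1 + b * x1' + c * x1'') (a * x2 + b * x2' + c * x2'')
     (a * y1 + b * y1' + c * y1'') (a * y2 + b * y2' + c * y2'')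
     (a * t + b * t' + c * t'').
Proof.
by congr (_, _, _); apply/rowP; apply/forall_ord2; rewrite !mxE.
Qed.

(** The Karush-Kuhn-Tucker conditions, up to a factor 2, for minimizing
    lam q(r) + (1 - x2) d1 p1^2 + (1 - x1) d2 p2^2 under y1 = lam r1 + (1 - x2) p1,
    y2 = lam r2 + (1 - x1) p2 and r >= 0: the multipliers of the two equations
    are d1 p1 and d2 p2, and half the gradient of q at r dominates them, with
    equality in the coordinates where r is positive. The weights cancel out. *)
Definition stationary (p1 p2 r1 r2 : R) :=
  [/\ [/\ 0 <= p1, 0 <= p2, 0 <= r1 & 0 <= r2],
      d1 * p1 <= d1 * r1 + r2, d2 * p2 <= r1 + d2 * r2,
      r1 * (d1 * r1 + r2 - d1 * p1) = 0 & r2 * (r1 + d2 * r2 - d2 * p2) = 0].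

Lemma stationary_quad p1 p2 r1 r2 : stationary p1 p2 r1 r2 ->
  quad r1 r2 = d1 * p1 * r1 + d2 * p2 * r2.
Proof.
by move=> [_ _ _ c1 c2]; rewrite /quad; lra.
Qed.

(** Where r_i is positive, the i-th inequality is an equality, and dropping the
    cross term from it leaves d_i r_i <= d_i p_i. *)
Lemma stationary_le p1 p2 r1 r2 : stationary p1 p2 r1 r2 -> r1 <= p1 /\ r2 <= p2.
Proof.
move=> [[p1_ge0 p2_ge0 r1_ge0 r2_ge0] _ _ c1 c2]; split.
- have [->//|r1_neq0] := eqVneq r1 0.
  move/eqP: c1; rewrite mulf_eq0 (negPf r1_neq0)/= => /eqP c1.
  by rewrite -(ler_pM2l d1_gt0); lra.
- have [->//|r2_neq0] := eqVneq r2 0.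
  move/eqP: c2; rewrite mulf_eq0 (negPf r2_neq0)/= => /eqP c2.
  by rewrite -(ler_pM2l d2_gt0); lra.
Qed.

(** This is the bound on K in [cl_hull_cut] for K = q(r): the origin is not
    below the cut although it carries no weight. *)
Lemma stationary_quad_le p1 p2 r1 r2 : stationary p1 p2 r1 r2 ->
  quad r1 r2 <= d1 * p1 ^+ 2 + d2 * p2 ^+ 2.
Proof.
move=> st; rewrite (stationary_quad st).
have [r1p1 r2p2] := stationary_le st.
case: st => -[p1_ge0 p2_ge0 _ _] _ _ _ _.
by rewrite lerD// expr2 mulrA ler_wpM2l ?mulr_ge0.
Qed.

(** The right side minus the left one is q(u - r) plus twice the pairing of u
    with the nonnegative slacks of the stationarity inequalities. *)
Lemma stationary_cut p1 p2 r1 r2 u1 u2 : stationary p1 p2 r1 r2 ->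
  0 <= u1 -> 0 <= u2 ->
  2 * (d1 * p1 * u1 + d2 * p2 * u2) <= quad u1 u2 + quad r1 r2.
Proof.
move=> [_ h1 h2 _ _] u1_ge0 u2_ge0; rewrite -subr_ge0.
have -> : quad u1 u2 + quad r1 r2 - 2 * (d1 * p1 * u1 + d2 * p2 * u2) =
  quad (u1 - r1) (u2 - r2) + 2 * ((d1 * r1 + r2 - d1 * p1) * u1)
  + 2 * ((r1 + d2 * r2 - d2 * p2) * u2) by rewrite /quad; ring.
by rewrite addr_ge0 ?[0 <= 2 * _]mulr_ge0 ?mulr_ge0 ?subr_ge0// addr_ge0 ?quad_ge0
  ?[0 <= 2 * _]mulr_ge0 ?mulr_ge0 ?subr_ge0.
Qed.

(** By [stationary_quad] the cost of the mixture is V = d1 p1 y1 + d2 p2 y2. The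
    cut with K = q(r) reads 2 V <= t + V, so it is exact. *)
Lemma cl_hull_stationary p1 p2 r1 r2 x1 x2 y1 y2 t :
  0 <= x1 <= 1 -> 0 <= x2 <= 1 -> 1 <= x1 + x2 ->
  stationary p1 p2 r1 r2 ->
  y1 = (x1 + x2 - 1) * r1 + (1 - x2) * p1 ->
  y2 = (x1 + x2 - 1) * r2 + (1 - x1) * p2 ->
  closure hullZ (pt x1 x2 y1 y2 t) <-> d1 * p1 * y1 + d2 * p2 * y2 <= t.
Proof.
move=> /andP[x1_ge0 x1_le1] /andP[x2_ge0 x2_le1] x12 st y1E y2E.
have VE : d1 * p1 * y1 + d2 * p2 * y2 = d1 * p1 ^+ 2 * (1 - x2)
    + d2 * p2 ^+ 2 * (1 - x1) + quad r1 r2 * (x1 + x2 - 1).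
  by rewrite (stationary_quad st) y1E y2E; ring.
split=> [Hp|Vt].
  have := cl_hull_cut (stationary_quad_le st)
    (fun u1 u2 => @stationary_cut _ _ _ _ u1 u2 st) Hp.
  by rewrite mulr2n mulrDl mul1r {2}VE; lra.
have [[p1_ge0 p2_ge0 r1_ge0 r2_ge0] _ _ _ _] := st.
(* Zplus is closed upwards in t, so the slack s is given to every vertex. *)
pose s := t - (d1 * p1 * y1 + d2 * p2 * y2).
have s_ge0 : 0 <= s by rewrite subr_ge0.
apply: (@hull_comb3 (x1 + x2 - 1) (1 - x2) (1 - x1) _ _ _ _ _
  (pt 1 1 r1 r2 (quad r1 r2 + s)) (pt 1 0 p1 0 (d1 * p1 ^+ 2 + s))
  (pt 0 1 0 p2 (d2 * p2 ^+ 2 + s))); rewrite ?subr_ge0//.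
- by ring.
- apply/Zplus_pt; split; [by right|by right| | |].
  + by rewrite subrr mulr0.
  + by rewrite subrr mulr0.
  + by split; [rewrite addr_ge0 ?quad_ge0|rewrite lerDl].
- apply/Zplus_pt; split; [by right|by left| | |].
  + by rewrite subrr mulr0.
  + by rewrite mul0r.
  + by split; [rewrite addr_ge0 ?mulr_ge0 ?sqr_ge0|lra].
- apply/Zplus_pt; split; [by left|by right| | |].
  + by rewrite mul0r.
  + by rewrite subrr mulr0.
  + by split; [rewrite addr_ge0 ?mulr_ge0 ?sqr_ge0|lra].
- rewrite comb3_pt; congr pt; rewrite ?y1E ?y2E; try ring.
  by rewrite /s VE; ring.
Qed.

(** With the whole remaining weight at the origin, the cut that is tight there is
    the one with K = d1 p1^2 + d2 p2^2; it is valid above (1,1) because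
    u1 u2 >= 0. *)
Lemma cl_hull_perspective p1 p2 x1 x2 t :
  0 <= x1 -> 0 <= x2 -> x1 + x2 <= 1 -> 0 <= p1 -> 0 <= p2 ->
  closure hullZ (pt x1 x2 (x1 * p1) (x2 * p2) t) <->
  d1 * p1 * (x1 * p1) + d2 * p2 * (x2 * p2) <= t.
Proof.
move=> x1_ge0 x2_ge0 x12 p1_ge0 p2_ge0; split=> [Hp|Vt].
  have := @cl_hull_cut p1 p2 (d1 * p1 ^+ 2 + d2 * p2 ^+ 2) _ _ _ _ _ _ _ Hp.
  rewrite lexx => /(_ isT); set V := d1 * p1 * (x1 * p1) + _.
  have -> : t + d1 * p1 ^+ 2 * (1 - x2) + d2 * p2 ^+ 2 * (1 - x1)
     + (d1 * p1 ^+ 2 + d2 * p2 ^+ 2) * (x1 + x2 - 1) = t + V by rewrite /V; ring.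
  move=> cut; suff: 2 * V <= t + V by lra.
  apply: cut => u1 u2 u1_ge0 u2_ge0; rewrite -subr_ge0.
  have -> : quad u1 u2 + (d1 * p1 ^+ 2 + d2 * p2 ^+ 2)
      - 2 * (d1 * p1 * u1 + d2 * p2 * u2) =
    d1 * (u1 - p1) ^+ 2 + d2 * (u2 - p2) ^+ 2 + 2 * (u1 * u2)
    by rewrite /quad; ring.
  have := mulr_ge0 d1_ge0 (sqr_ge0 (u1 - p1)); have := mulr_ge0 u1_ge0 u2_ge0.
  by have := mulr_ge0 d2_ge0 (sqr_ge0 (u2 - p2)); lra.
pose s := t - (d1 * p1 * (x1 * p1) + d2 * p2 * (x2 * p2)).
have s_ge0 : 0 <= s by rewrite subr_ge0.
apply: (@hull_comb3 (1 - x1 - x2) x1 x2 _ _ _ _ _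
  (pt 0 0 0 0 s) (pt 1 0 p1 0 (d1 * p1 ^+ 2 + s))
  (pt 0 1 0 p2 (d2 * p2 ^+ 2 + s))) => //.
- by lra.
- by ring.
- apply/Zplus_pt; split; [by left|by left| | |]; rewrite ?mul0r//.
  by split=> //; lra.
- apply/Zplus_pt; split; [by right|by left| | |].
  + by rewrite subrr mulr0.
  + by rewrite mul0r.
  + by split; [rewrite addr_ge0 ?mulr_ge0 ?sqr_ge0|lra].
- apply/Zplus_pt; split; [by left|by right| | |].
  + by rewrite mul0r.
  + by rewrite subrr mulr0.
  + by split; [rewrite addr_ge0 ?mulr_ge0 ?sqr_ge0|lra].
- by rewrite comb3_pt; congr pt; rewrite /s; ring.
Qed.

(** The cuts of slope d_i p_i in a single variable lose their quadratic term when
    x_i = 0 and become t >= 2 d_i p_i y_i for every p_i; taking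
    d_i p_i y_i = t + 1 is impossible as t >= 0. *)
Lemma cl_hull_support x1 x2 y1 y2 t : closure hullZ (pt x1 x2 y1 y2 t) ->
  (x1 = 0 -> y1 = 0) /\ (x2 = 0 -> y2 = 0).
Proof.
move=> Hp; have [_ _ y1_ge0 y2_ge0 t_ge0] := cl_hull_box Hp.
have quad_ge u1 u2 : 0 <= u1 -> 0 <= u2 ->
    d1 * u1 ^+ 2 + d2 * u2 ^+ 2 <= quad u1 u2.
  by move=> u1_ge0 u2_ge0; have := mulr_ge0 u1_ge0 u2_ge0; rewrite /quad; lra.
split=> [x10|x20].
- have [//|y10] := eqVneq y1 0; exfalso; pose p := (t + 1) / (d1 * y1).
  have pE : d1 * p * y1 = t + 1 by rewrite /p; field; rewrite y10 gt_eqF.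
  have cut := @cl_hull_cut p 0 (d1 * p ^+ 2) _ _ _ _ _ _ _ Hp.
  have /cut : forall u1 u2, 0 <= u1 -> 0 <= u2 ->
      2 * (d1 * p * u1 + d2 * 0 * u2) <= quad u1 u2 + d1 * p ^+ 2.
    move=> u1 u2 u1_ge0 u2_ge0; have := quad_ge u1 u2 u1_ge0 u2_ge0.
    have := mulr_ge0 d1_ge0 (sqr_ge0 (u1 - p)).
    have := mulr_ge0 d2_ge0 (sqr_ge0 u2); lra.
  by rewrite pE x10 => /(_ ltac:(lra)); lra.
- have [//|y20] := eqVneq y2 0; exfalso; pose p := (t + 1) / (d2 * y2).
  have pE : d2 * p * y2 = t + 1 by rewrite /p; field; rewrite y20 gt_eqF.
  have cut := @cl_hull_cut 0 p (d2 * p ^+ 2) _ _ _ _ _ _ _ Hp.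
  have /cut : forall u1 u2, 0 <= u1 -> 0 <= u2 ->
      2 * (d1 * 0 * u1 + d2 * p * u2) <= quad u1 u2 + d2 * p ^+ 2.
    move=> u1 u2 u1_ge0 u2_ge0; have := quad_ge u1 u2 u1_ge0 u2_ge0.
    have := mulr_ge0 d2_ge0 (sqr_ge0 (u2 - p)).
    have := mulr_ge0 d1_ge0 (sqr_ge0 u1); lra.
  by rewrite pE x20 => /(_ ltac:(lra)); lra.
Qed.

(** * The values of fplus *)

Lemma equot_fin (q r : R) : (r = 0 -> q = 0) -> equot q r = (q / r)%:E.
Proof.
rewrite /equot inver; case: eqP => [-> /(_ erefl) ->|_ _]; last by rewrite EFinM.
by rewrite mul0e mul0r.
Qed.

Lemma equot_infty (q : R) : 0 < q -> equot q 0 = +oo%E.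
Proof. by move=> q_gt0; rewrite /equot inve0 gt0_muley. Qed.

Lemma equot_ge0 (q r : R) : 0 <= q -> 0 <= r -> (0 <= equot q r)%E.
Proof. by move=> q_ge0 r_ge0; rewrite /equot mule_ge0 ?inve_ge0. Qed.

Lemma le_quotE (l a b : R) : 0 <= b -> le_quot l a b = (l * b <= a).
Proof.
rewrite /le_quot; case: eqP => // b0; rewrite le_eqVlt => /orP[/eqP bE|b_gt0].
  by rewrite -bE in b0.
by rewrite ler_pdivlMr.
Qed.

Lemma fplus_perspective x1 x2 y1 y2 : x1 + x2 <= 1 ->
  (x1 = 0 -> y1 = 0) -> (x2 = 0 -> y2 = 0) ->
  fplus (pair_row x1 x2) (pair_row y1 y2) d =
  (d1 * (y1 / x1) * y1 + d2 * (y2 / x2) * y2)%:E.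
Proof.
move=> x12 s1 s2; rewrite /fplus !pair_row0 !pair_row1 x12.
rewrite !equot_fin -?EFinD; last 2 first.
- by move=> /s2 ->; rewrite expr0n mulr0.
- by move=> /s1 ->; rewrite expr0n mulr0.
by congr _%:E; ring.
Qed.

Lemma fplus_support x1 x2 y1 y2 t : 0 <= x1 -> 0 <= x2 -> x1 + x2 <= 1 ->
  (fplus (pair_row x1 x2) (pair_row y1 y2) d <= t%:E)%E ->
  (x1 = 0 -> y1 = 0) /\ (x2 = 0 -> y2 = 0).
Proof.
move=> x1_ge0 x2_ge0 x12; rewrite /fplus !pair_row0 !pair_row1 x12 => ft.
have q1_ge0 : 0 <= d1 * y1 ^+ 2 by rewrite mulr_ge0 ?sqr_ge0.
have q2_ge0 : 0 <= d2 * y2 ^+ 2 by rewrite mulr_ge0 ?sqr_ge0.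
split=> x0; apply/eqP; apply: contraTT ft => y0; rewrite -ltNge x0.
- have q1_gt0 : 0 < d1 * y1 ^+ 2 by rewrite mulr_gt0// exprn_even_gt0.
  by rewrite equot_infty// addye ?ltry// gt_eqF// (lt_le_trans ltNy0) ?equot_ge0.
- have q2_gt0 : 0 < d2 * y2 ^+ 2 by rewrite mulr_gt0// exprn_even_gt0.
  by rewrite addeC equot_infty// addye ?ltry// gt_eqF// (lt_le_trans ltNy0) ?equot_ge0.
Qed.

(** After clearing denominators, the case conditions say
    d1 x2 y1 <= (1 - x2) y2, resp. d2 x1 y2 <= (1 - x1) y1. They are the
    stationarity inequalities of the solutions with r1 = 0, resp. r2 = 0, and
    their failure is the positivity of r1 and r2 in the interior solution. The
    denominator of f is positive also when d1 d2 = 1, because it equals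
    (d1 d2 - 1) x1 x2 + lam. *)
Lemma fplus_stationary x1 x2 y1 y2 : 0 <= x1 <= 1 -> 0 <= x2 <= 1 ->
  1 < x1 + x2 -> 0 <= y1 -> 0 <= y2 ->
  exists p1 p2 r1 r2, [/\ stationary p1 p2 r1 r2,
    y1 = (x1 + x2 - 1) * r1 + (1 - x2) * p1,
    y2 = (x1 + x2 - 1) * r2 + (1 - x1) * p2 &
    fplus (pair_row x1 x2) (pair_row y1 y2) d =
      (d1 * p1 * y1 + d2 * p2 * y2)%:E].
Proof.
move=> /andP[x1_ge0 x1_le1] /andP[x2_ge0 x2_le1] x12 y1_ge0 y2_ge0.
have x1_gt0 : 0 < x1 by lra.
have x2_gt0 : 0 < x2 by lra.
have lam_ge0 : 0 <= x1 + x2 - 1 by lra.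
rewrite /fplus !pair_row0 !pair_row1 leNgt x12 lam_ge0/= !le_quotE//.
have -> : ((x1 + x2 - 1) * y2 <= x1 * y2 - d1 * x2 * y1) =
  (d1 * x2 * y1 <= (1 - x2) * y2) by apply/idP/idP; lra.
have -> : ((x1 + x2 - 1) * y1 <= x2 * y1 - d2 * x1 * y2) =
  (d2 * x1 * y2 <= (1 - x1) * y1) by apply/idP/idP; lra.
case: ifPn => [c2|]; last (rewrite -ltNge => n2; case: ifPn => [c3|]).
- have s1 : 1 - x2 = 0 -> y1 = 0.
    move=> x20; move: c2; rewrite x20 mul0r pmulr_rle0 ?mulr_gt0//.
    by move=> y1_le0; apply/eqP; rewrite eq_le y1_le0.
  (* With r1 = 0 nothing couples y2 to y1: y2 spreads evenly over the total
     weight x2. If x2 = 1, the vertex (1,0) has no weight and p1 is 0. *)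
  exists (y1 / (1 - x2)), (y2 / x2), 0, (y2 / x2); split.
  + split; rewrite ?mul0r ?mulr0 ?add0r ?subrr ?mulr0//.
      by rewrite !divr_ge0 ?subr_ge0.
    have [x20|x2_neq1] := eqVneq (1 - x2) 0.
      by rewrite x20 invr0 !mulr0 divr_ge0.
    have ? : 0 < 1 - x2 by rewrite lt_def x2_neq1 subr_ge0.
    by rewrite mulrA ler_pdivrMr// mulrAC ler_pdivlMr// mulrAC [y2 * _]mulrC.
  + rewrite mulr0 add0r; have [x20|x2_neq1] := eqVneq (1 - x2) 0.
      by rewrite x20 mul0r s1.
    by rewrite mulrC divfK.
  + by field; rewrite gt_eqF.
  + rewrite !equot_fin -?EFinD; last 2 first.
    * by move=> /s1 ->; rewrite expr0n mulr0.
    * by move=> x20; rewrite x20 ltxx in x2_gt0.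
    by congr _%:E; ring.
- have s2 : 1 - x1 = 0 -> y2 = 0.
    move=> x10; move: c3; rewrite x10 mul0r pmulr_rle0 ?mulr_gt0//.
    by move=> y2_le0; apply/eqP; rewrite eq_le y2_le0.
  exists (y1 / x1), (y2 / (1 - x1)), (y1 / x1), 0; split.
  + split; rewrite ?mul0r ?mulr0 ?addr0 ?subrr ?mulr0//.
      by rewrite !divr_ge0 ?subr_ge0.
    have [x10|x1_neq1] := eqVneq (1 - x1) 0.
      by rewrite x10 invr0 !mulr0 divr_ge0.
    have ? : 0 < 1 - x1 by rewrite lt_def x1_neq1 subr_ge0.
    by rewrite mulrA ler_pdivrMr// mulrAC ler_pdivlMr// mulrAC [y1 * _]mulrC.
  + by field; rewrite gt_eqF.
  + rewrite mulr0 add0r; have [x10|x1_neq1] := eqVneq (1 - x1) 0.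
      by rewrite x10 mul0r s2.
    by rewrite mulrC divfK.
  + rewrite !equot_fin -?EFinD; last 2 first.
    * by move=> /s2 ->; rewrite expr0n mulr0.
    * by move=> x10; rewrite x10 ltxx in x1_gt0.
    by congr _%:E; ring.
- rewrite -ltNge => n3.
  pose den := (d1 * d2 - 1) * x1 * x2 + (x1 + x2 - 1).
  have den_gt0 : 0 < den.
    by rewrite ltr_wpDl ?subr_gt0// !mulr_ge0// subr_ge0.
  have den_neq0 : (d1 * d2 - 1) * x1 * x2 + (x1 + x2 - 1) != 0 by rewrite gt_eqF.
  have d10 : d1 != 0 by rewrite gt_eqF.
  have d20 : d2 != 0 by rewrite gt_eqF.
  have D_ge0 : 0 <= d1 * d2 - 1 by rewrite subr_ge0.
  (* Here p solves the linear system d1 p1 = d1 r1 + r2, d2 p2 = r1 + d2 r2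
     together with the two equations for y. *)
  pose p1 := (((d1 * d2 - 1) * x2 + (x1 + x2 - 1)) * y1
              + (x1 + x2 - 1) * d2 * y2) / den.
  pose p2 := (((d1 * d2 - 1) * x1 + (x1 + x2 - 1)) * y2
              + (x1 + x2 - 1) * d1 * y1) / den.
  pose r1 := d2 * (d1 * x2 * y1 - (1 - x2) * y2) / den.
  pose r2 := d1 * (d2 * x1 * y2 - (1 - x1) * y1) / den.
  have e1 : d1 * p1 = d1 * r1 + r2 by rewrite /p1 /r1 /r2 /den; field.
  have e2 : d2 * p2 = r1 + d2 * r2 by rewrite /p2 /r1 /r2 /den; field.
  exists p1, p2, r1, r2; split.
  + split; rewrite ?e1 ?e2 ?subrr ?mulr0//; split.
    * exact: divr_ge0 (addr_ge0 (mulr_ge0 (addr_ge0 (mulr_ge0 D_ge0 x2_ge0)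
        lam_ge0) y1_ge0) (mulr_ge0 (mulr_ge0 lam_ge0 d2_ge0) y2_ge0)) (ltW den_gt0).
    * exact: divr_ge0 (addr_ge0 (mulr_ge0 (addr_ge0 (mulr_ge0 D_ge0 x1_ge0)
        lam_ge0) y2_ge0) (mulr_ge0 (mulr_ge0 lam_ge0 d1_ge0) y1_ge0)) (ltW den_gt0).
    * by rewrite divr_ge0 ?(ltW den_gt0)// mulr_ge0// subr_ge0 ltW.
    * by rewrite divr_ge0 ?(ltW den_gt0)// mulr_ge0// subr_ge0 ltW.
  + by rewrite /p1 /r1 /den; field.
  + by rewrite /p2 /r2 /den; field.
  + rewrite /f !pair_row0 !pair_row1.
    have -> : (d1 * d2 - 1) * x1 * x2 - (x1 + x2 - 1) ^+ 2
       + (x1 + x2 - 1) * (x1 + x2) = den by rewrite /den; ring.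
    rewrite equot_fin; last by move=> /eqP; rewrite gt_eqF.
    by congr _%:E; rewrite /p1 /p2 /den; field.
Qed.

End Hull.

Unset Implicit Arguments.
Set Strict Implicit.

Theorem proposition2 (R : realType) (d : 'rV[R]_2)
    (d1_ge0 : 0 <= d 0 0) (d2_ge0 : 0 <= d 0 1) (d1d2_ge1 : 1 <= d 0 0 * d 0 1) :
  closure (conv_hull (Zplus d)) =
  [set p : xyt_space R |
    [/\ forall i : 'I_2, 0 <= p.1.1 0 i <= 1,
        forall i : 'I_2, 0 <= p.1.2 0 i,
        0 <= p.2
      & (fplus p.1.1 p.1.2 d <= p.2%:E)%E]].
Proof.
apply/seteqP.
suff H x1 x2 y1 y2 t : 0 <= x1 <= 1 -> 0 <= x2 <= 1 -> 0 <= y1 -> 0 <= y2 ->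
    closure (conv_hull (Zplus d)) (pt x1 x2 y1 y2 t) <->
    (fplus (pair_row x1 x2) (pair_row y1 y2) d <= t%:E)%E.
  split=> p; rewrite (pt_eta p) /=.
    move=> Hp; have [hx1 hx2 hy1 hy2 ht] := cl_hull_box Hp.
    split; [apply/forall_ord2|apply/forall_ord2|exact: ht|exact/H];
      by rewrite pair_row0 pair_row1.
  move=> [/forall_ord2[+ +] /forall_ord2[+ +] _ ft].
  by rewrite !pair_row0 !pair_row1 => *; apply/H.
move=> hx1 hx2 y1_ge0 y2_ge0.
have /andP[x1_ge0 _] := hx1; have /andP[x2_ge0 _] := hx2.
have [x12|x12] := leP (x1 + x2) 1; last first.
  have [p1 [p2 [r1 [r2 [st y1E y2E ->]]]]] :=
    fplus_stationary d1_ge0 d2_ge0 d1d2_ge1 hx1 hx2 x12 y1_ge0 y2_ge0.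
  rewrite lee_fin.
  exact: (cl_hull_stationary d1_ge0 d2_ge0 d1d2_ge1 _ hx1 hx2 (ltW x12) st y1E y2E).
have persp : (x1 = 0 -> y1 = 0) /\ (x2 = 0 -> y2 = 0) ->
    closure (conv_hull (Zplus d)) (pt x1 x2 y1 y2 t) <->
    (fplus (pair_row x1 x2) (pair_row y1 y2) d <= t%:E)%E.
  move=> [s1 s2]; rewrite fplus_perspective// lee_fin.
  have mulfVK x y : (x = 0 -> y = 0) -> x * (y / x) = y :> R.
    by have [->|x0] := eqVneq x 0; [move=> ->//; rewrite mul0r|
      move=> _; rewrite mulrC divfK].
  have := @cl_hull_perspective _ _ d1_ge0 d2_ge0 (y1 / x1) (y2 / x2)
    x1 x2 t x1_ge0 x2_ge0 x12.
  by rewrite !mulfVK//; apply; rewrite divr_ge0.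
split=> h; apply/persp => //; last first.
  by apply: fplus_support h.
by apply: cl_hull_support h.
Qed.
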